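(* For every $\beta\in(1,+\infty)\setminus\mathbb{N}$, Lebesgue almost every $x\in I_\beta$ has infinitely many balanced $\beta$-expansions.
   Context: $\mathbb{N}=\{1,2,3,\dots\}$ and $\lfloor\beta\rfloor$ is the greatest integer $\le\beta$. For a non-integer $\beta>1$, the alphabet is $\mathcal{A}_\beta=\{0,1,\dots,\lfloor\beta\rfloor\}$ and $I_\beta=[0,\frac{\lfloor\beta\rfloor}{\beta-1}]$. A $\beta$-expansion of $x\in\mathbb{R}$ is a sequence $(\epsilon_i)_{i\ge1}\in\mathcal{A}_\beta^{\mathbb{N}}$ with $x=\sum_{i=1}^\infty \epsilon_i\beta^{-i}$. For a sequence $(\epsilon_i)_{i\ge1}\in\{0,1,\dots,m\}^{\mathbb{N}}$, the frequency of the digit $k$ is $\mathrm{Freq}_k(\epsilon_i)=\lim_{n\to\infty}\frac{\#\{1\le i\le n:\epsilon_i=k\}}{n}$, assuming the limit exists. The sequence is called balanced if, for all $k\in\{0,1,\dots,m\}$, these frequencies exist and $\mathrm{Freq}_k(\epsilon_i)=\mathrm{Freq}_{m-k}(\epsilon_i)$. For $\beta$-expansions with $\beta$ a non-integer, $m=\lfloor\beta\rfloor$. *)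

(* Defs.v *)
From mathcomp Require Import all_boot all_order all_algebra.
From mathcomp Require Import all_classical all_reals all_analysis.

Set Implicit Arguments.
Unset Strict Implicit.
Unset Printing Implicit Defensive.

Import Order.TTheory GRing.Theory Num.Theory.
Import numFieldNormedType.Exports.

Local Open Scope classical_set_scope.
Local Open Scope ring_scope.

(* Digit sequences over {0, ..., m} are functions e : nat -> 'I_m.+1, where
   e i is the (i+1)-th digit: sequences are 0-based here, whereas the usual
   notation (epsilon_i)_(i >= 1) is 1-based. *)

(* The term n = 0 has the irrelevant value 0 (division by 0). *)
Definition digit_freq_seq (R : realType) (m : nat) (e : nat -> 'I_m.+1)
    (k : 'I_m.+1) : R^nat :=
  fun n => #|[pred i : 'I_n | e i == k]|%:R / n%:R.

Definition Freq (R : realType) (m : nat) (k : 'I_m.+1)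
    (e : nat -> 'I_m.+1) : R :=
  limn (digit_freq_seq R e k).

(* rev_ord k is the digit m - k. *)
Definition balanced (R : realType) (m : nat) (e : nat -> 'I_m.+1) : Prop :=
  (forall k : 'I_m.+1, cvgn (digit_freq_seq R e k)) /\
  (forall k : 'I_m.+1, Freq R k e = Freq R (rev_ord k) e).

(* Num.truncn beta is the floor of beta, as a natural number, when beta >= 0. *)
Definition is_beta_expansion (R : realType) (beta x : R)
    (e : nat -> 'I_(Num.truncn beta).+1) : Prop :=
  series (fun i : nat => (e i)%:R / beta ^+ i.+1) @ \oo --> x.

Definition I_beta (R : realType) (beta : R) : set R :=
  [set x | 0 <= x <= (Num.truncn beta)%:R / (beta - 1)].

(* Main.v *)
Require Import Defs.
From mathcomp Require Import all_boot all_order all_algebra.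
From mathcomp Require Import all_classical all_reals all_analysis.
From mathcomp Require Import ring lra zify.

Import Order.TTheory GRing.Theory Num.Theory.
Import numFieldNormedType.Exports.

Local Open Scope classical_set_scope.
Local Open Scope ring_scope.

(* Write M = m / (beta - 1), m = floor beta, so that I = [0, M] with M > 1 because
   beta < m + 1; hence the inverse branches y |-> (y + k) / beta map I to
   intervals covering I with overlaps of length (M - 1) / beta. For a suitable
   L, every interval K in I that is not too short can therefore be tiled by
   finitely many sets T_w (K'), where T_w is the inverse branch of a word w of
   length L and K' is again a subinterval of I that is not too short, in such a
   way that two of the K' are I itself. Iterating such tilings from I codes
   every x in I by a beta-expansion, and when x is chosen uniformly the coding
   is a Markov chain on intervals with a uniform positive probability of
   jumping to the state I. By this Doeblin condition the number of occurrences
   of a digit in n blocks has mean n mu + O(1) and variance O(n), so Chebyshev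
   and Borel-Cantelli along the squares give the existence of the frequencies
   almost everywhere. The states carry a sign: negative ones are tiled by the
   mirror image under x |-> M - x, k |-> m - k, and of the two special tiles one
   leads to (I, +) and the other to (I, -). The chain is then invariant under
   the mirror symmetry, so the digits k and m - k have the same frequency.
   Finally the special tiles lie in overlaps, where another digit is possible.
   Almost every x meets them infinitely often, and at each of those times one
   may switch to the other digit and continue with a balanced expansion of the
   resulting point; this gives infinitely many different expansions. *)

(** * Averages and Markov chains *)

Section WeightedAverage.
Context {R : realType} {T : eqType} {r : seq T} {p : T -> R}.
Hypothesis p_ge0 : forall c, c \in r -> 0 <= p c.
Hypothesis p_sum : \sum_(c <- r) p c = 1.

Lemma wavg_cst (B : R) : \sum_(c <- r) p c * B = B.
Proof. by rewrite -mulr_suml p_sum mul1r. Qed.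

Lemma ler_wavg (f g : T -> R) : (forall c, c \in r -> f c <= g c) ->
  \sum_(c <- r) p c * f c <= \sum_(c <- r) p c * g c.
Proof.
move=> fg; rewrite big_seq [leRHS]big_seq; apply: ler_sum => c cr.
by rewrite ler_wpM2l ?p_ge0 ?fg.
Qed.

Lemma wavg_le (f : T -> R) (B : R) : (forall c, c \in r -> f c <= B) ->
  \sum_(c <- r) p c * f c <= B.
Proof. by move=> /ler_wavg; rewrite wavg_cst. Qed.

Lemma wavg_ge (f : T -> R) (B : R) : (forall c, c \in r -> B <= f c) ->
  B <= \sum_(c <- r) p c * f c.
Proof. by move=> /ler_wavg; rewrite wavg_cst. Qed.

Lemma wavg_norm_le (f : T -> R) (B : R) : (forall c, c \in r -> `|f c| <= B) ->
  `|\sum_(c <- r) p c * f c| <= B.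
Proof.
move=> fB; rewrite ler_norml wavg_le ?wavg_ge// => c cr;
by have := fB _ cr; rewrite ler_norml => /andP[].
Qed.

(* The variance is at most the second moment about any point z. *)
Lemma wavg_sqr_le (f : T -> R) (a z B : R) :
  (forall c, c \in r -> `|f c - z| <= B) ->
  \sum_(c <- r) p c * (a + f c) ^+ 2 <= (a + \sum_(c <- r) p c * f c) ^+ 2 + B ^+ 2.
Proof.
move=> fB; set e := \sum_(c <- r) p c * f c.
have -> : \sum_(c <- r) p c * (a + f c) ^+ 2 =
    (a + e) ^+ 2 + \sum_(c <- r) p c * (f c - z) ^+ 2 - (e - z) ^+ 2.
  have -> : \sum_(c <- r) p c * (f c - z) ^+ 2 =
      \sum_(c <- r) p c * (a + f c) ^+ 2 +
      (- (a + z) * 2) * \sum_(c <- r) p c * f c + (z ^+ 2 - a ^+ 2).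
    rewrite -[z ^+ 2 - a ^+ 2]wavg_cst mulr_sumr -!big_split/=.
    by apply: eq_bigr => c _; ring.
  by rewrite -/e; ring.
have : \sum_(c <- r) p c * (f c - z) ^+ 2 <= B ^+ 2.
  apply: wavg_le => c cr; rewrite -[leLHS]real_normK ?num_real//.
  by rewrite lerXn2r ?nnegrE ?fB// (le_trans _ (fB _ cr)).
by have := sqr_ge0 (e - z); lra.
Qed.

End WeightedAverage.

(** As in Fekete's lemma: comparing [a p] and [a n] with [a (n * p)] shows that each [(a p - C) / p]
    is at most each [(a n + C) / n]; a supremum separates the two families. *)
Lemma quasi_additive_linear {R : realType} (a : nat -> R) (C : R) :
  (forall n p, `|a (n + p)%N - a n - a p| <= C) ->
  exists mu, forall n, `|a n - n%:R * mu| <= C.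
Proof.
move=> aC.
have aC' n p : a n + a p - C <= a (n + p)%N <= a n + a p + C.
  by have := aC n p; rewrite ler_norml => /andP[? ?]; apply/andP; split; lra.
have C0 : 0 <= C by rewrite (le_trans _ (aC 0%N 0%N)).
have aMs p n : n.+1%:R * a p - n.+1%:R * C <= a (n.+1 * p)%N <=
    n.+1%:R * a p + n.+1%:R * C.
  elim: n => [|n /andP[? ?]]; first by rewrite mul1n !mul1r; apply/andP; split; lra.
  rewrite mulSn -[n.+2%:R]natr1 !mulrDl !mul1r.
  by have /andP[? ?] := aC' p (n.+1 * p)%N; apply/andP; split; lra.
pose E := [set (a p.+1 - C) / p.+1%:R | p in [set: nat]].
have Eub n : ubound E ((a n.+1 + C) / n.+1%:R).
  move=> _ [p _ <-]; rewrite ler_pdivrMr// mulrAC ler_pdivlMr//.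
  have /andP[+ _] := aMs p.+1 n; have /andP[_ +] := aMs n.+1 p.
  rewrite mulnC; set A := a (_ * _)%N; set n' := n.+1%:R; set p' := p.+1%:R.
  rewrite -/n' -/p'; lra.
exists (sup E) => -[|n].
  by have := aC 0%N 0%N; rewrite addn0 subrr sub0r normrN mul0r subr0.
have h1 : (a n.+1 - C) / n.+1%:R <= sup E.
  by apply: ub_le_sup; [exists ((a 1%N + C) / 1%:R); exact: Eub|exists n].
have h2 : sup E <= (a n.+1 + C) / n.+1%:R.
  by apply: ge_sup; [exists ((a 1%N - C) / 1%:R); exists 0%N|exact: Eub].
move: h1 h2; rewrite ler_pdivrMr// ler_pdivlMr// ler_norml => h1 h2.
by apply/andP; split; lra.
Qed.

Lemma rate_unique {R : realType} (a : nat -> R) (mu nu C D : R) :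
  (forall n, `|a n - n%:R * mu| <= C) -> (forall n, `|a n - n%:R * nu| <= D) ->
  mu = nu.
Proof.
move=> amu anu; apply/eqP; rewrite -subr_eq0 -normr_eq0; apply/eqP/le_anti.
rewrite normr_ge0 andbT; apply/ler_addgt0Pl => e e0; rewrite addr0.
have h n : n%:R * `|mu - nu| <= C + D.
  rewrite -[n%:R]ger0_norm// -normrM.
  have -> : n%:R * (mu - nu) = (a n - n%:R * nu) - (a n - n%:R * mu) by ring.
  by apply: (le_trans (ler_normB _ _)); rewrite addrC lerD.
have CD : 0 <= C + D by apply: le_trans (h 0%N); rewrite mul0r.
have /andP[_ t] := truncn_itv (divr_ge0 CD (ltW e0)).
rewrite leNgt; apply/negP => emu.
have := h (Num.truncn ((C + D) / e)).+1; apply/negP; rewrite -ltNge.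
rewrite ltr_pdivrMr// in t; apply: (lt_trans t).
by rewrite ltr_pM2l.
Qed.

(* A Markov chain whose states s have the finitely many successors c.2,
   c \in rule s, reached with probability wt s c while emitting the label c.1. *)
Section Chain.
Context (R : realType) (W S : eqType).
Variables (rule : S -> seq (W * S)) (wt : S -> W * S -> R) (valid : pred S).
Variables (s0 : S) (kappa : R).
Hypothesis valid0 : valid s0.
Hypothesis kappa_gt0 : 0 < kappa.
Hypothesis rule_valid : forall s c, valid s -> c \in rule s -> valid c.2.
Hypothesis wt_ge0 : forall s, valid s -> forall c, c \in rule s -> 0 <= wt s c.
Hypothesis wt_sum : forall s, valid s -> \sum_(c <- rule s) wt s c = 1.
Hypothesis to_s0 : forall s, valid s ->
  exists2 c, c \in rule s & c.2 = s0 /\ kappa <= wt s c.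

Variable (g : W -> R).

(** Expectations are computed by conditioning on the first step, so that no measure on paths is
    needed. *)
Fixpoint chain_mean n s : R :=
  if n is n'.+1 then \sum_(c <- rule s) wt s c * (g c.1 + chain_mean n' c.2)
  else 0.

(** The expected square of [a] plus the sum of [g] over [n] labels; the accumulator [a] carries the
    labels already read. *)
Fixpoint chain_sqmean n s (a : R) : R :=
  if n is n'.+1 then \sum_(c <- rule s) wt s c * chain_sqmean n' c.2 (a + g c.1)
  else a ^+ 2.

Variable (G : R).
Hypothesis g_bound : forall w, 0 <= g w <= G.

Let D := G / kappa.

(** Doeblin contraction: since every state sends mass [kappa] to [s0], one step multiplies the
    spread of the means by [1 - kappa] and adds at most [G]; [D] is the fixed point of this
    bound. *)
Lemma chain_mean_center n :
  exists z, forall s, valid s -> `|chain_mean n s - z| <= D.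
Proof.
elim: n => [|n [z zP]].
  have G0 : 0 <= G.
    have [c _ _] := to_s0 _ valid0.
    by have /andP[h1 h2] := g_bound c.1; exact: le_trans h2.
  by exists 0 => s _; rewrite subrr normr0 divr_ge0// ltW.
(* The mass [kappa] sent to [s0] shifts the center by the same amount for every [s]. *)
exists (z + kappa * (chain_mean n s0 - z)) => s sv /=.
have [c0 c0s [c0E c0w]] := to_s0 _ sv.
have -> : \sum_(c <- rule s) wt s c * (g c.1 + chain_mean n c.2) =
    \sum_(c <- rule s) wt s c * g c.1 + z +
    \sum_(c <- rule s) wt s c * (chain_mean n c.2 - z).
  rewrite -[X in _ + X + _](wavg_cst (wt_sum _ sv)) -!big_split/=.
  by apply: eq_bigr => c _; ring.
have gle : 0 <= \sum_(c <- rule s) wt s c * g c.1 <= G.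
  apply/andP; split.
    by apply: wavg_ge; [exact: wt_ge0|exact: wt_sum|move=> c _; case/andP: (g_bound c.1)].
  by apply: wavg_le; [exact: wt_ge0|exact: wt_sum|move=> c _; case/andP: (g_bound c.1)].
have h : `|\sum_(c <- rule s) wt s c * (chain_mean n c.2 - z)
          - kappa * (chain_mean n s0 - z)| <= (1 - kappa) * D.
  have pr := perm_to_rem c0s.
  have := wt_sum _ sv; rewrite !(perm_big _ pr)/= !big_cons c0E => ws.
  have -> : (1 - kappa) * D =
      (wt s c0 - kappa) * D + \sum_(c <- rem c0 (rule s)) wt s c * D.
    by rewrite -mulr_suml -ws; ring.
  rewrite addrAC -mulrBl; apply: (le_trans (ler_normD _ _)); apply: lerD.
    by rewrite normrM ger0_norm ?subr_ge0// ler_wpM2l ?subr_ge0// zP.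
  apply: (le_trans (ler_norm_sum _ _ _)).
  rewrite big_seq [leRHS]big_seq; apply: ler_sum => c /mem_rem cs.
  by rewrite normrM ger0_norm ?wt_ge0// ler_wpM2l ?wt_ge0// zP// (rule_valid _ _ sv).
have DE : D = (1 - kappa) * D + G.
  by rewrite /D; field; rewrite gt_eqF.
rewrite DE; case/andP: gle => g1 g2; move: h; rewrite !ler_norml => /andP[h1 h2].
by apply/andP; split; lra.
Qed.

Lemma chain_mean_close n s t : valid s -> valid t ->
  `|chain_mean n s - chain_mean n t| <= 2 * D.
Proof.
move=> sv tv; have [z zP] := chain_mean_center n.
have := zP _ sv; have := zP _ tv; rewrite !ler_norml => /andP[? ?] /andP[? ?].
by apply/andP; split; lra.
Qed.

(** Whatever state is reached after [n] steps, the mean over [p] further steps is within [2 * D] of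
    the one from [t]. *)
Lemma chain_meanD n p s t : valid s -> valid t ->
  `|chain_mean (n + p) s - chain_mean n s - chain_mean p t| <= 2 * D.
Proof.
move=> + tv; elim: n s => [|n IH] s sv.
  by rewrite add0n subr0 chain_mean_close.
rewrite addSn /= -sumrB -[chain_mean p t](wavg_cst (wt_sum _ sv)) -sumrB.
under eq_bigr do rewrite -!mulrBr opprD addrACA subrr add0r.
apply: wavg_norm_le; [exact: wt_ge0|exact: wt_sum|].
by move=> c cs; apply: IH; exact: (rule_valid _ _ sv).
Qed.

Lemma chain_mean_linear : exists mu, forall n s, valid s ->
  `|chain_mean n s - n%:R * mu| <= 4 * D.
Proof.
have [|mu muP] := @quasi_additive_linear _ (chain_mean ^~ s0) (2 * D).
  by move=> n p; exact: chain_meanD.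
exists mu => n s sv.
have := chain_mean_close n s s0 sv valid0; have := muP n.
rewrite !ler_norml => /andP[? ?] /andP[? ?].
by apply/andP; split; lra.
Qed.

(** Each step adds the variance of one martingale increment, which [wavg_sqr_le] bounds by the
    constant [(G + D) ^+ 2]. *)
Lemma chain_sqmean_le n s a : valid s ->
  chain_sqmean n s a <= (a + chain_mean n s) ^+ 2 + n%:R * (G + D) ^+ 2.
Proof.
elim: n s a => [|n IH] s a sv /=; first by rewrite addr0 mul0r addr0.
have [z zP] := chain_mean_center n.
have cv c : c \in rule s -> valid c.2 by exact: rule_valid.
apply: (@le_trans _ _ (\sum_(c <- rule s)
    wt s c * ((a + (g c.1 + chain_mean n c.2)) ^+ 2 + n%:R * (G + D) ^+ 2))).
  apply: ler_wavg => [c|c cs]; first exact: wt_ge0.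
  by rewrite addrA; apply: IH; exact: cv.
rewrite (eq_bigr _ (fun c _ => mulrDr (wt s c) _ _)) big_split/=.
rewrite wavg_cst ?wt_sum// -natr1 mulrDl mul1r [leRHS]addrCA [leLHS]addrC lerD2l.
apply: (@wavg_sqr_le _ _ _ _ _ _ (fun c => g c.1 + chain_mean n c.2) a z).
- exact: wt_ge0.
- exact: wt_sum.
move=> c cs.
have := zP _ (cv _ cs); have /andP[? ?] := g_bound c.1.
by rewrite !ler_norml => /andP[? ?]; apply/andP; split; lra.
Qed.

(* The rate cancels the means, so only the variance, linear in n, remains. *)
Lemma chain_rate : exists mu C, 0 <= C /\ forall n s, valid s ->
  chain_sqmean n s (- (n%:R * mu)) <= C * n.+1%:R /\
  `|chain_mean n s - n%:R * mu| <= C.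
Proof.
have [mu muP] := chain_mean_linear.
have D0 : 0 <= 4 * D by rewrite (le_trans _ (muP 0%N _ valid0)).
pose C := 4 * D + (4 * D) ^+ 2 + (G + D) ^+ 2.
have C1 := sqr_ge0 (4 * D); have C2 := sqr_ge0 (G + D).
exists mu, C; split; first by rewrite /C; lra.
move=> n s sv; split; last by apply: (le_trans (muP n s sv)); rewrite /C; lra.
apply: (le_trans (chain_sqmean_le _ _ _ sv)).
have h : (- (n%:R * mu) + chain_mean n s) ^+ 2 <= (4 * D) ^+ 2.
  rewrite addrC -[leLHS]real_normK ?num_real//.
  by rewrite lerXn2r ?nnegrE ?muP.
have n0 : 0 <= n%:R :> R by [].
rewrite -natr1 mulrDr mulr1 mulrC -/C.
have : (G + D) ^+ 2 * n%:R <= C * n%:R by rewrite ler_wpM2r// /C; lra.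
rewrite /C in h *; lra.
Qed.

(** This will make the rate of the tiles lying in overlaps positive. *)
Lemma chain_mean_ge n s : valid s ->
  (forall t, valid t -> exists2 c, c \in rule t & kappa <= wt t c /\ 1 <= g c.1) ->
  n%:R * kappa <= chain_mean n s.
Proof.
move=> + gP; elim: n s => [|n IH] s sv /=; first by rewrite mul0r.
under eq_bigr do rewrite mulrDr.
rewrite big_split/= -natr1 mulrDl mul1r [leLHS]addrC; apply: lerD.
  have [c0 c0s [kc gc]] := gP _ sv.
  rewrite (perm_big _ (perm_to_rem c0s))/= big_cons -[kappa]addr0.
  apply: lerD; first by rewrite -[kappa]mulr1 ler_pM// ltW.
  rewrite big_seq; apply: sumr_ge0 => c /mem_rem cs.
  by rewrite mulr_ge0 ?wt_ge0//; case/andP: (g_bound c.1).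
apply: wavg_ge; [exact: wt_ge0|exact: wt_sum|].
by move=> c cs; apply: IH; exact: (rule_valid _ _ sv).
Qed.

End Chain.

(** * Null sets and digit frequencies *)

Section IntervalCovers.
Context {R : realType}.

Definition intervals (l : seq (R * R)) : set R :=
  [set x | exists2 i, i \in l & i.1 <= x <= i.2].

(** An upper bound on outer measure by finite covers, which spares any proof that the covered set is
    measurable. *)
Definition interval_cover (A : set R) (r : R) : Prop := exists l : seq (R * R),
  [/\ forall i, i \in l -> i.1 <= i.2, A `<=` intervals l &
      \sum_(i <- l) (i.2 - i.1) <= r].

Lemma interval_coverS (A B : set R) (r r' : R) : A `<=` B -> r <= r' ->
  interval_cover B r -> interval_cover A r'.
Proof.
move=> AB rr' [l [l1 l2 l3]]; exists l; split=> //; last exact: le_trans rr'.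
exact: subset_trans l2.
Qed.

Lemma interval_cover_bigU (T : eqType) (s : seq T) (A : T -> set R) (r : T -> R) :
  (forall c, c \in s -> interval_cover (A c) (r c)) ->
  interval_cover [set x | exists2 c, c \in s & A c x] (\sum_(c <- s) r c).
Proof.
elim: s => [|c s IH] h.
  by exists [::]; split=> // [x [c]|]; rewrite ?big_nil.
have [l [l1 l2 l3]] := h c (mem_head _ _).
have [|l' [l1' l2' l3']] := IH.
  by move=> d ds; apply: h; rewrite inE ds orbT.
exists (l ++ l'); split.
- by move=> i; rewrite mem_cat => /orP[/l1|/l1'].
- move=> x [d]; rewrite inE => /predU1P[->/l2[i il ix]|ds dx].
    by exists i => //; rewrite mem_cat il.
  have [|i il ix] := l2' x; first by exists d.
  by exists i => //; rewrite mem_cat il orbT.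
by rewrite big_cat big_cons lerD.
Qed.

Lemma interval_cover_affine (A : set R) (r k t : R) : 0 < k ->
  interval_cover A r -> interval_cover [set x | A (k * x + t)] (r / k).
Proof.
move=> k0 [l [l1 l2 l3]].
exists [seq ((i.1 - t) / k, (i.2 - t) / k) | i <- l]; split.
- by move=> _ /mapP[i /l1 h ->] /=; rewrite ler_pM2r ?invr_gt0//; lra.
- move=> x /l2[i il ix]; exists ((i.1 - t) / k, (i.2 - t) / k).
    by apply/mapP; exists i.
  by rewrite /= ler_pdivrMr// ler_pdivlMr//; apply/andP; move: ix => /andP[]; split; lra.
rewrite big_map (eq_bigr (fun i => (i.2 - i.1) / k)); last by move=> i _ /=; ring.
by rewrite -mulr_suml ler_pM2r ?invr_gt0.
Qed.

Lemma measurable_intervals (l : seq (R * R)) : measurable (intervals l) /\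
  ((forall i, i \in l -> i.1 <= i.2) ->
   (@lebesgue_measure R (intervals l) <= (\sum_(i <- l) (i.2 - i.1))%:E)%E).
Proof.
elim: l => [|i l [m1 IH]].
  rewrite (_ : intervals [::] = set0); last by apply/seteqP; split=> x [].
  by split=> // _; rewrite measure0 big_nil.
rewrite (_ : intervals (i :: l) = `[i.1, i.2]%classic `|` intervals l); last first.
  apply/seteqP; split=> x.
    move=> [j]; rewrite inE => /predU1P[->|jl] jx; first by left; rewrite /= in_itv.
    by right; exists j.
  move=> [|[j jl jx]]; last by exists j; rewrite // inE jl orbT.
  by rewrite /= in_itv/= => h; exists i; rewrite ?mem_head.
have mi := @measurable_itv R `[i.1, i.2].
split=> [|h]; first exact: measurableU.
apply: (@le_trans _ _ (@lebesgue_measure R `[i.1, i.2]%classic +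
  @lebesgue_measure R (intervals l))%E); first exact: measureU2.
rewrite big_cons EFinD; apply: leeD; last first.
  by apply: IH => j jl; apply: h; rewrite inE jl orbT.
rewrite lebesgue_measure_itv/= lte_fin; case: ifP => // _.
by rewrite lee_fin subr_ge0 h ?mem_head.
Qed.

(** Borel-Cantelli applied to the covers, which are measurable even if the sets [A j] are not. *)
Lemma limsup_cover_negligible (A : nat -> set R) (r : nat -> R) (B : R) :
  (forall j, interval_cover (A j) (r j)) ->
  (forall n, \sum_(0 <= j < n) r j <= B) ->
  (@lebesgue_measure R).-negligible
    [set x | forall N, exists2 j, (N <= j)%N & A j x].
Proof.
move=> Ar rB.
have /choice[l lP] j : exists l : seq (R * R),
  [/\ forall i, i \in l -> i.1 <= i.2, A j `<=` intervals l &
      \sum_(i <- l) (i.2 - i.1) <= r j] by exact: Ar.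
exists (lim_sup_set (fun j => intervals (l j))); split.
- apply: bigcap_measurable => // n _; apply: bigcup_measurable => j _.
  by have [] := measurable_intervals (l j).
- apply: lim_sup_set_cvg0 => [j|]; first by have [] := measurable_intervals (l j).
  apply: (@le_lt_trans _ _ B%:E); last exact: ltry.
  apply: lime_le; first by apply: is_cvg_nneseries.
  apply: nearW => n.
  apply: (@le_trans _ _ (\sum_(0 <= j < n) r j)%:E); last by rewrite lee_fin.
  rewrite -sumEFin; apply: lee_sum => j _.
  have [l1 _ l3] := lP j; have [_ /(_ l1) h] := measurable_intervals (l j).
  by apply: (le_trans h); rewrite lee_fin.
move=> x Ax N _; have [j Nj Ajx] := Ax N.
by exists j => //=; have [_ + _] := lP j; exact.
Qed.

End IntervalCovers.

Lemma sum_inv_sqr_le {R : realType} n :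
  \sum_(0 <= j < n) (j.+1%:R ^+ 2)^-1 <= 2 :> R.
Proof.
case: n => [|n]; first by rewrite big_geq.
(* The sharper bound telescopes, hence survives the induction. *)
suff : \sum_(0 <= j < n.+1) (j.+1%:R ^+ 2)^-1 <= 2 - n.+1%:R^-1 :> R.
  by move/le_trans; apply; rewrite lerBlDr lerDl invr_ge0.
elim: n => [|n IH]; first by rewrite big_nat1 expr1n invr1; lra.
rewrite big_nat_recr//=; apply: (le_trans (lerD IH (lexx _))).
have n0 : 0 < n.+1%:R :> R by [].
rewrite -[n.+2%:R]natr1; set x := n.+1%:R in n0 *.
rewrite -subr_ge0.
have -> : 2 - (x + 1)^-1 - (2 - x^-1 + ((x + 1) ^+ 2)^-1) =
  (x * (x + 1) ^+ 2)^-1 by field; rewrite !gt_eqF//; lra.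
by rewrite invr_ge0 mulr_ge0 ?sqr_ge0// ltW.
Qed.

Lemma infinite_set_unbounded {E : Type} (A : set E) (J : nat -> Prop) (f : nat -> E) :
  (forall n, exists2 j, (n <= j)%N & J j) -> (forall j, J j -> A (f j)) ->
  (forall i j, J i -> J j -> (i < j)%N -> f i <> f j) -> infinite_set A.
Proof.
move=> Jub JA fJ finA.
have /choice[nx nxP] n : exists j, (n <= j)%N /\ J j.
  by have [j nj Jj] := Jub n; exists j.
pose s n := iter n (fun i => nx i.+1) (nx 0%N).
have Js n : J (s n) by case: n => [|n]; [case: (nxP 0%N)|case: (nxP (s n).+1)].
have ss i j : (i < j)%N -> (s i < s j)%N.
  elim: j => // j IH; rewrite ltnS leq_eqVlt => /predU1P[->|/IH h].
    by case: (nxP (s j).+1).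
  by apply: (ltn_trans h); case: (nxP (s j).+1).
apply: infinite_nat; rewrite (_ : [set: nat] = (f \o s) @^-1` A).
  apply: finite_preimage finA => i j _ _ /= fij.
  by case: (ltngtP i j) => // /ss h; [have := fJ _ _ (Js i) (Js j) h|
    have := fJ _ _ (Js j) (Js i) h; move/(_ (esym fij))].
by apply/seteqP; split=> // n _; exact: JA.
Qed.

Lemma prefix_chain_limit {T : eqType} (x0 : T) (u b : nat -> seq T) :
  (forall n, u n.+1 = u n ++ b n) -> (forall n, (0 < size (b n))%N) ->
  exists e : nat -> T, forall n, mkseq e (size (u n)) = u n.
Proof.
(* Digit [i] is read off [u i.+1], which is longer than [i] because no [b n] is empty. *)
move=> uS b0; pose e i := nth x0 (u i.+1) i; exists e => n.
have usz i : (i <= size (u i))%N.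
  elim: i => // i IH; rewrite uS size_cat -addn1 leq_add//.
have upre i j : (i <= j)%N -> exists v, u j = u i ++ v.
  elim: j => [|j IH]; first by rewrite leqn0 => /eqP->; exists [::]; rewrite cats0.
  rewrite leq_eqVlt => /predU1P[->|/IH[v vE]]; first by exists [::]; rewrite cats0.
  by exists (v ++ b j); rewrite uS vE catA.
apply: (@eq_from_nth _ x0); rewrite size_mkseq// => i iu.
rewrite nth_mkseq// /e; case: (leqP i.+1 n) => [/upre|/ltnW/upre] [v ->].
  by rewrite nth_cat usz.
by rewrite nth_cat iu.
Qed.

Lemma take_mkseq {T : Type} (e : nat -> T) i j : (i <= j)%N ->
  take i (mkseq e j) = mkseq e i.
Proof.
by move=> ij; rewrite /mkseq -map_take take_iota (minn_idPl ij).
Qed.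

Lemma digit_freq_seqE {R : realType} m (e : nat -> 'I_m.+1) (k : 'I_m.+1) n :
  digit_freq_seq R e k n = (count_mem k (mkseq e n))%:R / n%:R.
Proof.
rewrite /digit_freq_seq; congr (_%:R / _).
rewrite -sum1_card -sum1_count big_map -[n in iota 0 n]subn0 -/(index_iota 0 n).
by rewrite big_mkord; apply: eq_bigl => i; rewrite inE.
Qed.

(* Squares are sparse enough for the second moment bound to be summable and
   dense enough for a counting function to be controlled between them. *)
Lemma cvg_average_squares {R : realType} (C : nat -> nat) (q L : nat) (mu : R) :
  (forall n p, (C n <= C (n + p) <= C n + p)%N) -> (0 < L)%N ->
  (forall eps : R, 0 < eps -> exists J, forall j, (J <= j)%N ->
    `|(C (q + j ^ 2 * L)%N)%:R - (j ^ 2)%:R * mu| <= eps * (j ^ 2)%:R) ->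
  (C n)%:R / n%:R @[n --> \oo] --> mu / L%:R.
Proof.
move=> Cm L0 CP; apply/cvgrPdist_le => eps eps0.
have L0' : 0 < L%:R :> R by rewrite ltr0n.
have eps2 : 0 < eps / 2 by rewrite divr_gt0.
have [J JP] := CP _ eps2.
(* [K * j] bounds the errors due to the offset [q] and to the gap between consecutive squares; the
   factor 3 comes from [2 j + 1 <= 3 j]. *)
pose K : R := (L%:R + `|mu| * (q%:R + L%:R) / L%:R) * 3.
pose J' := (maxn J (Num.truncn (2 * K / eps)).+1).
exists (q + J' ^ 2 * L)%N => // n /= nJ.
(* [n] is compared with the last sampled time before it. *)
pose P j := (q + j ^ 2 * L <= n)%N.
have Pub j : P j -> (j <= n)%N.
  rewrite /P => h; apply: leq_trans h; rewrite -mulnn -mulnA.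
  case: j => // j; apply: leq_trans (leq_addl _ _).
  by apply: leq_pmulr; rewrite muln_gt0.
have [j Pj jmax] := ex_maxnP (ex_intro P _ nJ) Pub.
have J'j : (J' <= j)%N by exact: jmax.
have jn : (n < q + j.+1 ^ 2 * L)%N.
  by rewrite ltnNge; apply/negP => /jmax; rewrite ltnn.
have Jj : (J <= j)%N by rewrite (leq_trans _ J'j)// leq_maxl.
have := JP _ Jj; set N := (q + j ^ 2 * L)%N => CN.
have nN : n = (N + (n - N))%N by rewrite subnKC.
have := Cm N (n - N)%N; rewrite -nN => /andP[Cn1 Cn2].
have nN' : (n - N <= (j.*2.+1) * L)%N by rewrite /N; nia.
have j1 : (1 <= j)%N by rewrite (leq_trans _ J'j)// leq_max orbT.
have Kj : 2 * K / eps <= j%:R.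
  have K0 : 0 <= 2 * K / eps.
    apply: divr_ge0; last exact: ltW.
    by rewrite !mulr_ge0 ?addr_ge0 ?mulr_ge0 ?invr_ge0 ?addr_ge0.
  have /andP[_ /ltW/le_trans] := truncn_itv K0; apply.
  by rewrite ler_nat (leq_trans _ J'j)// leq_maxr.
have jn' : (j ^ 2 <= n)%N by rewrite (leq_trans _ Pj)// /N; nia.
have n0 : (0 < n)%N by rewrite (leq_trans _ jn')// expn_gt0 j1.
have n0' : 0 < n%:R :> R by rewrite ltr0n.
have -> : mu / L%:R - (C n)%:R / n%:R = (n%:R * mu / L%:R - (C n)%:R) / n%:R.
  by field; rewrite !gt_eqF.
rewrite normrM [`|n%:R^-1|]gtr0_norm ?invr_gt0// ler_pdivrMr//.
have nE : n%:R = (j ^ 2)%:R * L%:R + q%:R + (n - N)%:R :> R.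
  by rewrite -natrM -!natrD; congr _%:R; rewrite {1}nN /N; lia.
have -> : n%:R * mu / L%:R - (C n)%:R = mu * (q%:R + (n - N)%:R) / L%:R -
    ((C N)%:R - (j ^ 2)%:R * mu) - ((C n)%:R - (C N)%:R).
  by rewrite [in LHS]nE; field; rewrite gt_eqF.
have j1' : 1 <= j%:R :> R by rewrite ler1n.
have nN3 : (n - N)%:R <= 3 * j%:R * L%:R :> R.
  by rewrite -!natrM ler_nat; nia.
have Cn3 : `|(C n)%:R - (C N)%:R| <= 3 * j%:R * L%:R :> R.
  rewrite ger0_norm ?subr_ge0 ?ler_nat// lerBlDr addrC.
  by apply: (le_trans _ (lerD (lexx _) nN3)); rewrite -natrD ler_nat.
have m3 : `|mu * (q%:R + (n - N)%:R) / L%:R| <=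
    `|mu| * (q%:R + L%:R) / L%:R * 3 * j%:R.
  rewrite !normrM [`|L%:R^-1|]gtr0_norm ?invr_gt0//.
  rewrite [`|q%:R + _|]ger0_norm ?addr_ge0//.
  have -> : `|mu| * (q%:R + L%:R) / L%:R * 3 * j%:R =
    `|mu| * ((q%:R + L%:R) * 3 * j%:R) / L%:R by ring.
  rewrite ler_wpM2r ?invr_ge0// ler_wpM2l//.
  have : q%:R <= q%:R * j%:R :> R by rewrite ler_peMr.
  by have : 0 <= q%:R * j%:R :> R by []; lra.
apply: (le_trans (ler_normB _ _)); apply: (@le_trans _ _
  (`|mu| * (q%:R + L%:R) / L%:R * 3 * j%:R + eps / 2 * (j ^ 2)%:R + 3 * j%:R * L%:R)).
  by apply: lerD => //; apply: (le_trans (ler_normB _ _)); apply: lerD.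
have -> : `|mu| * (q%:R + L%:R) / L%:R * 3 * j%:R + eps / 2 * (j ^ 2)%:R
    + 3 * j%:R * L%:R = K * j%:R + eps / 2 * (j ^ 2)%:R by rewrite /K; ring.
have h : K * j%:R <= eps / 2 * (j ^ 2)%:R.
  rewrite natrX expr2 mulrA ler_wpM2r//.
  by move: Kj; rewrite ler_pdivrMr//; lra.
have : eps * (j ^ 2)%:R <= eps * n%:R by rewrite ler_wpM2l ?ler_nat// ltW.
lra.
Qed.

(** * Words, tilings and codings *)

Section BetaMaps.
Context (R : realType) (m : nat) (beta : R).
Hypotheses (beta_gt1 : 1 < beta) (beta_ltm : beta < m.+1%:R).

Let word := seq 'I_m.+1.
(* (a, c, b) is the interval [a, c]; the sign b tells whether it is subdivided
   by a fixed rule or by the mirror image of that rule. *)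
Let state := (R * R * bool)%type.

(** The rescaled remainder: [beta ^+ n] times the difference of [x] and the partial sum with digits
    [w], where [n] is the length of [w]. *)
Definition psi (x : R) (w : word) : R :=
  foldl (fun y (k : 'I_m.+1) => beta * y - k%:R) x w.

Let M : R := m%:R / (beta - 1).
(** The least admissible length of a state. A single word can keep any interval of scaled length up
    to [M - 1] inside I, and cutting longer ones into equal pieces loses at most a factor 2. *)
Let delta : R := (M - 1) / 2.

Definition in_I (x : R) : bool := 0 <= x <= M.

Let b1 : 0 < beta - 1. Proof. by rewrite subr_gt0. Qed.
Let b0 : 0 < beta. Proof. by apply: lt_trans beta_gt1. Qed.
Let M_fix : beta * M = M + m%:R.
Proof. by rewrite /M; field; rewrite gt_eqF. Qed.
Let M_gt1 : 1 < M.
Proof. by rewrite /M ltr_pdivlMr// mul1r ltrBlDr natr1. Qed.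
Let M_gt0 : 0 < M. Proof. exact: lt_trans M_gt1. Qed.
Let delta_gt0 : 0 < delta. Proof. by rewrite /delta; have := M_gt1; lra. Qed.
Let bX n : 0 < beta ^+ n. Proof. by rewrite exprn_gt0. Qed.

Let m_gt0 : (0 < m)%N.
Proof.
have h := lt_trans beta_gt1 beta_ltm.
by move: h; rewrite -[X in X < _]/(1%:R) ltr_nat.
Qed.

Lemma psi_cat x u v : psi x (u ++ v) = psi (psi x u) v.
Proof. exact: foldl_cat. Qed.

Lemma psiB x y w : psi x w - psi y w = beta ^+ size w * (x - y).
Proof.
elim: w x y => [|k w IH] x y /=; first by rewrite mul1r.
by rewrite IH exprSr; ring.
Qed.

Lemma psiE x w : psi x w = beta ^+ size w * x + psi 0 w.
Proof. by have := psiB x 0 w; rewrite subr0 => <-; rewrite subrK. Qed.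

(** Points outside I never come back, as [beta * M - m = M]; so being in I need only be checked at
    the end of a word. *)
Lemma in_I_psi x w : in_I (psi x w) -> in_I x.
Proof.
elim: w x => [//|k w IH] x /= /IH; rewrite /in_I => /andP[h1 h2].
have k0 : 0 <= k%:R :> R by [].
have km : k%:R <= m%:R :> R by rewrite ler_nat -ltnS.
apply/andP; split; first by rewrite -(pmulr_rge0 _ b0); lra.
by rewrite -(ler_pM2l b0) M_fix; lra.
Qed.

Lemma psi_rev x w : psi (M - x) (map (@rev_ord _) w) = M - psi x w.
Proof.
elim: w x => [//|k w IH] x /=.
have -> : beta * (M - x) - (rev_ord k)%:R = M - (beta * x - k%:R).
  rewrite mulrBr M_fix /= subSS natrB ?[(k <= m)%N]leq_ord//; first by ring.
by rewrite IH.
Qed.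

Lemma in_I_rev x : in_I (M - x) = in_I x.
Proof. by rewrite /in_I; apply/idP/idP => /andP[? ?]; apply/andP; split; lra. Qed.

(* The images of I under the m + 1 inverse branches overlap in intervals of
   length (M - 1) / beta. *)
Lemma short_interval_word n a c : 0 <= a -> a <= c -> c <= M ->
  beta ^+ n * (c - a) <= M - 1 ->
  exists w : word, size w = n /\ in_I (psi a w) /\ in_I (psi c w).
Proof.
elim: n a c => [|n IH] a c a0 ac cM h.
  by exists [::]; split => //=; split; apply/andP; split=> //; lra.
have ba0 : 0 <= beta * a by rewrite mulr_ge0// ltW.
have h' : beta * (c - a) <= M - 1.
  apply: le_trans h; rewrite exprSr -mulrA; apply: ler_peMl.
    by rewrite mulr_ge0 ?subr_ge0// ltW.
  by rewrite exprn_ege1// ltW.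
have bcM : beta * c <= M + m%:R by rewrite -M_fix ler_pM2l.
have /andP[t1 t2] := truncn_itv ba0.
(* The greedy digit of the left end, capped at [m]. If the cap acts, [c <= M] keeps the right end in
   I; otherwise the length bound [M - 1] does. *)
pose k : 'I_m.+1 := inord (minn m (Num.truncn (beta * a))).
have kE : k = minn m (Num.truncn (beta * a)) :> nat.
  by rewrite inordK// ltnS geq_minl.
have [k1 k2] : (k%:R <= beta * a) /\ (beta * c - k%:R <= M).
  rewrite kE /minn; case: ltnP => [mt|tm].
    by split; [rewrite (le_trans _ t1)// ler_nat ltnW|lra].
  split=> //; move: t2 h'; rewrite -natr1 mulrBr; lra.
have bac : beta * a <= beta * c by rewrite ler_pM2l.
have [||||w [sw [wa wc]]] := IH (beta * a - k%:R) (beta * c - k%:R) => //.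
- by rewrite subr_ge0.
- by rewrite lerD2r.
- by apply: le_trans h; rewrite exprSr le_eqVlt; apply/orP; left; apply/eqP; ring.
by exists (k :: w); rewrite /= sw.
Qed.

(* Points with an expansion starting with w also have one that leaves w before
   its end. *)
Definition has_alternative (w : word) : Prop :=
  exists w' : word, [/\ (size w' <= size w)%N, take (size w') w <> w' &
    forall x, in_I (psi x w) -> in_I (psi x w')].

Lemma has_alternative_rev w : has_alternative w ->
  has_alternative (map (@rev_ord _) w).
Proof.
move=> [w' [s1 s2 s3]]; exists (map (@rev_ord _) w'); rewrite !size_map.
split=> // [|x].
  by rewrite -map_take => /(inj_map rev_ord_inj).
by rewrite -[x](subKr M) !psi_rev !in_I_rev; exact: s3.
Qed.

Let one : 'I_m.+1 := inord 1.

Let psi_nseq0 x r : psi x (nseq r (ord0 : 'I_m.+1)) = beta ^+ r * x.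
Proof.
elim: r x => [|r IH] x /=; first by rewrite mul1r.
by rewrite IH exprSr; ring.
Qed.

(** A point that stays in I under [r] zeros is at most [M - 1]. Hence before the digit 1 it was in
    the overlap where the digit 0 is possible too. *)
Lemma alternative_cat r (u : word) : M <= beta ^+ r * (M - 1) ->
  has_alternative (u ++ one :: nseq r ord0).
Proof.
move=> rM; exists (rcons u ord0); rewrite size_rcons size_cat /=.
have oneE : one = 1%N :> nat by rewrite inordK.
split; first by lia.
  rewrite -cat_rcons -(size_rcons u one) take_size_cat// => /rcons_inj[].
  by move/(congr1 (@nat_of_ord _)); rewrite oneE.
move=> x; rewrite -cats1 !psi_cat/= psi_nseq0 oneE subr0.
set y := beta * _; rewrite /in_I => /andP[h1 h2].
have y1 : 1 <= y by rewrite -subr_ge0 -(pmulr_rge0 _ (bX r)).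
apply/andP; split; first by lra.
have : beta ^+ r * (y - 1) <= beta ^+ r * (M - 1) by exact: le_trans rM.
by rewrite ler_pM2l//; lra.
Qed.

(** * Tilings of intervals by inverse branches *)

Definition len (s : state) : R := s.1.2 - s.1.1.
Definition valid (s : state) : bool :=
  [&& 0 <= s.1.1, s.1.2 <= M & delta <= len s].

Definition covers (l : seq (word * state)) (a c : R) : Prop :=
  forall x, a <= x <= c -> exists2 d, d \in l & d.2.1.1 <= psi x d.1 <= d.2.1.2.

(** The length identity replaces disjointness of the tiles: it makes the transition probabilities
    sum to 1. *)
Definition tiling n (l : seq (word * state)) (a c : R) : Prop :=
  [/\ forall d, d \in l -> size d.1 = n /\ valid d.2,
      \sum_(d <- l) len d.2 = beta ^+ n * (c - a) & covers l a c].

Lemma tiling_cat n l1 l2 a c d : tiling n l1 a c -> tiling n l2 c d ->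
  tiling n (l1 ++ l2) a d.
Proof.
move=> [v1 s1 c1] [v2 s2 c2]; split.
- by move=> e; rewrite mem_cat => /orP[/v1|/v2].
- by rewrite big_cat/= s1 s2; ring.
move=> x /andP[ax xd]; have [xc|cx] := leP x c.
  have [|e e1 e2] := c1 x; first by rewrite ax.
  by exists e; rewrite // mem_cat e1.
have [|e e1 e2] := c2 x; first by rewrite ltW.
by exists e; rewrite // mem_cat e1 orbT.
Qed.

Lemma tiling_seq1 n (w : word) a c s : size w = n -> a <= c ->
  valid (psi a w, psi c w, s) ->
  tiling n [:: (w, (psi a w, psi c w, s))] a c.
Proof.
move=> sw ac v; split.
- by move=> d; rewrite inE => /eqP ->.
- by rewrite big_seq1 /len/= psiB sw.
move=> x /andP[ax xc]; exists (w, (psi a w, psi c w, s)); first by rewrite inE.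
rewrite /= -subr_ge0 psiB -[X in _ && X]subr_ge0 psiB.
by rewrite !mulr_ge0 ?subr_ge0// exprn_ge0// ltW.
Qed.

Lemma tiling_short n a c : 0 <= a -> c <= M ->
  delta <= beta ^+ n * (c - a) <= M - 1 -> exists l, tiling n l a c.
Proof.
move=> a0 cM /andP[h1 h2].
have ac : a <= c.
  by rewrite -subr_ge0 -(pmulr_rge0 _ (bX n)); apply: le_trans h1; exact: ltW.
have [w [sw [/andP[wa _] /andP[_ wc]]]] := short_interval_word n _ _ a0 ac cM h2.
exists [:: (w, (psi a w, psi c w, true))]; apply: tiling_seq1 => //.
by rewrite /valid wa wc /len /= psiB sw.
Qed.

Lemma tiling_pieces n N a h : 0 <= a -> a + N.+1%:R * h <= M -> 0 <= h ->
  delta <= beta ^+ n * h <= M - 1 -> exists l, tiling n l a (a + N.+1%:R * h).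
Proof.
move=> a0 + h0 hh; elim: N => [|N IH] aM.
  by apply: tiling_short => //; rewrite mul1r [X in X - a]addrC addrK.
have aE : a + N.+2%:R * h = a + N.+1%:R * h + h by rewrite -[N.+2%:R]natr1; ring.
have aM' : a + N.+1%:R * h <= M by move: aM; rewrite aE; lra.
have [l1 t1] := IH aM'.
have [|||l2 t2] := tiling_short n (a + N.+1%:R * h) (a + N.+2%:R * h) => //.
- by rewrite addr_ge0// mulr_ge0.
- by rewrite aE [X in X - _]addrC addrK.
by exists (l1 ++ l2); exact: tiling_cat t1 t2.
Qed.

Lemma tiling_long n a c : 0 <= a -> c <= M -> M - 1 <= beta ^+ n * (c - a) ->
  exists l, tiling n l a c.
Proof.
move=> a0 cM h.
have e0 : 0 < M - 1 by rewrite subr_gt0.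
have B0 : 0 <= beta ^+ n * (c - a) / (M - 1).
  by apply: divr_ge0; [apply: le_trans h; exact: ltW|exact: ltW].
have /andP[t1 t2] := truncn_itv B0.
(* In units of [M - 1] the scaled length is at least 1 and lies between [N] and [N + 1], so each of
   [N + 1] equal pieces has scaled length between [delta] and [M - 1]. *)
set N := Num.truncn _ in t1 t2.
have B1 : 1 <= beta ^+ n * (c - a) / (M - 1) by rewrite ler_pdivlMr// mul1r.
have N0 : (0 : R) < N.+1%:R by [].
pose s := (c - a) / N.+1%:R.
have cE : c = a + N.+1%:R * s by rewrite /s; field; rewrite gt_eqF.
have s0 : 0 <= s.
  rewrite divr_ge0// -(pmulr_rge0 _ (bX n)).
  by apply: le_trans h; exact: ltW.
rewrite cE; apply: tiling_pieces => //; first by rewrite -cE.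
rewrite /s mulrA; apply/andP; split.
  rewrite ler_pdivlMr// /delta.
  move: t1 B1; rewrite !ler_pdivlMr// -[N.+1%:R]natr1; lra.
by move: t2; rewrite ltr_pdivrMr// ler_pdivrMr//; lra.
Qed.

Lemma expr_unbounded (x : R) : exists n, x <= beta ^+ n.
Proof.
have h n : n%:R * (beta - 1) <= beta ^+ n.
  elim: n => [|n IH]; first by rewrite mul0r.
  have : 1 <= beta ^+ n by rewrite exprn_ege1// ltW.
  rewrite -natr1 exprSr; set B := beta ^+ n => B1.
  have : (beta - 1) * 1 <= (beta - 1) * B by rewrite ler_pM2l.
  by rewrite /B in IH *; lra.
exists (Num.truncn (`|x| / (beta - 1))).+1; apply: le_trans (h _).
rewrite -ler_pdivrMr//; apply: (@le_trans _ _ (`|x| / (beta - 1))).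
  by rewrite ler_pM2r ?invr_gt0// ler_norm.
by have /andP[_ /ltW] := truncn_itv (divr_ge0 (normr_ge0 x) (ltW b1)).
Qed.

(** A word [u] of length [n] keeping [x] in I, followed by 1 and [r] zeros, maps some [[p, q]] onto
    I. Both [x] and [[p, q]] stay in I under [u], so they are within
    [M / beta ^+ n <= delta / 12]. *)
Lemma alternative_copy n r x : in_I x ->
  12 * M <= delta * beta ^+ n -> M <= beta ^+ r * (M - 1) ->
  exists w p q, [/\ size w = (n + r.+1)%N, has_alternative w,
    psi p w = 0 /\ psi q w = M, p <= q &
    x - delta / 12 <= p /\ q <= x + delta / 12].
Proof.
move=> /andP[x0 xM] nP rP.
have [|u [su [xu _]]] := short_interval_word n x x x0 (lexx x) xM.
  by rewrite subrr mulr0 subr_ge0 ltW.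
pose w := u ++ one :: nseq r ord0.
have sw : size w = (n + r.+1)%N by rewrite size_cat/= size_nseq su.
pose p := - psi 0 w / beta ^+ size w.
pose q := (M - psi 0 w) / beta ^+ size w.
have pE : psi p w = 0 by rewrite psiE /p; field; rewrite gt_eqF.
have qE : psi q w = M by rewrite psiE /q; field; rewrite gt_eqF.
have near y : in_I (psi y w) -> x - delta / 12 <= y <= x + delta / 12.
  rewrite psi_cat => /in_I_psi/andP[h1 h2]; move: xu => /andP[h3 h4].
  have e := psiB y x u; rewrite su in e.
  have e1 : beta ^+ n * (y - x) <= beta ^+ n * (delta / 12) by rewrite -e; lra.
  have e2 : beta ^+ n * (x - y) <= beta ^+ n * (delta / 12).
    by rewrite -opprB mulrN -e; lra.
  by rewrite !ler_pM2l// in e1 e2; apply/andP; split; lra.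
exists w, p, q; split=> //.
- exact: alternative_cat.
- by rewrite /p /q ler_pM2r ?invr_gt0//; lra.
have /near/andP[-> _] : in_I (psi p w) by rewrite pE /in_I lexx ltW.
by have /near/andP[_ ->] : in_I (psi q w) by rewrite qE /in_I lexx andbT ltW.
Qed.

Definition rich_tiling n (l : seq (word * state)) (a c : R) : Prop :=
  tiling n l a c /\ forall s, exists2 d, d \in l &
    d.2 = (0, M, s) /\ has_alternative d.1.

(** Two copies of I, one for each sign, are placed near the points at one and two thirds of the
    interval; the three remaining gaps are tiled by [tiling_long]. *)
Lemma rich_tiling_exists : exists2 n, (0 < n)%N &
  forall a c s, valid (a, c, s) -> exists l, rich_tiling n l a c.
Proof.
have [n1 n1P] := expr_unbounded (12 * M / delta).
have [r rP] := expr_unbounded (M / (M - 1)).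
have e0 : 0 < M - 1 by rewrite subr_gt0.
have {}rP : M <= beta ^+ r * (M - 1) by rewrite -ler_pdivrMr.
have {}n1P : 12 * M <= delta * beta ^+ n1.
  by rewrite [leRHS]mulrC -ler_pdivrMr.
have dM : delta <= M by rewrite /delta; have := M_gt1; lra.
have b12 : 12 <= beta ^+ (n1 + r.+1).
  apply: (@le_trans _ _ (beta ^+ n1)).
    rewrite -(ler_pM2l M_gt0) [M * 12]mulrC; apply: (le_trans n1P).
    by rewrite ler_pM2r.
  by rewrite ler_weXn2l ?leq_addr// ltW.
exists (n1 + r.+1)%N => [|a c s /and3P[/= a0 cM]]; first by rewrite addnS.
rewrite /len/= => h.
(* Each gap has length at least [delta / 6], and [12 * (delta / 6) = M - 1]. *)
have gap p q : 0 <= p -> q <= M -> delta / 6 <= q - p ->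
    exists l, tiling (n1 + r.+1) l p q.
  move=> p0 qM pq; apply: tiling_long => //.
  apply: (@le_trans _ _ (12 * (q - p))); first by rewrite /delta in pq *; lra.
  by rewrite ler_wpM2r//; have := delta_gt0; lra.
have d0 := delta_gt0.
have x1I : in_I (a + (c - a) / 3) by apply/andP; split; lra.
have [w1 [p1 [q1 [sw1 alt1 [P1 Q1] pq1 [p1x q1x]]]]] :=
  alternative_copy n1 r _ x1I n1P rP.
have x2I : in_I (a + (c - a) * 2 / 3) by apply/andP; split; lra.
have [w2 [p2 [q2 [sw2 alt2 [P2 Q2] pq2 [p2x q2x]]]]] :=
  alternative_copy n1 r _ x2I n1P rP.
have [|||l1 t1] := gap a p1; [lra|lra|lra|].
have [|||l2 t2] := gap q1 p2; [lra|lra|lra|].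
have [|||l3 t3] := gap q2 c; [lra|lra|lra|].
have vI b : valid (0, M, b) by rewrite /valid /len/= lexx subr0 lexx.
have t1' : tiling (n1 + r.+1) [:: (w1, (0, M, true))] p1 q1.
  by rewrite -P1 -Q1; apply: tiling_seq1 => //; rewrite P1 Q1.
have t2' : tiling (n1 + r.+1) [:: (w2, (0, M, false))] p2 q2.
  by rewrite -P2 -Q2; apply: tiling_seq1 => //; rewrite P2 Q2.
have t := tiling_cat _ _ _ _ _ _ (tiling_cat _ _ _ _ _ _ (tiling_cat _ _ _ _ _ _
  (tiling_cat _ _ _ _ _ _ t1 t1') t2) t2') t3.
exists ((((l1 ++ [:: (w1, (0, M, true))]) ++ l2) ++ [:: (w2, (0, M, false))]) ++ l3).
split=> // -[]; [exists (w1, (0, M, true))|exists (w2, (0, M, false))] => //;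
by rewrite !mem_cat !inE eqxx ?orbT.
Qed.

(** The remainders are bounded by [M], so the error of the partial sums is at most
    [M / beta ^+ n]. *)
Lemma expansion_cvg (e : nat -> 'I_m.+1) (x : R) :
  (forall n, in_I (psi x (mkseq e n))) ->
  series (fun i : nat => (e i)%:R / beta ^+ i.+1) @ \oo --> x.
Proof.
move=> eI; set u := series _.
have uE n : psi x (mkseq e n) = beta ^+ n * (x - u n).
  elim: n => [|n IH]; first by rewrite /u seriesEnat/= big_geq// subr0 mul1r.
  rewrite mkseqS -cats1 psi_cat IH /u !seriesEnat/= big_nat_recr//= exprS.
  by field; rewrite !gt_eqF.
apply/cvgrPdist_le => eps eps0.
have [N NP] := expr_unbounded (M / eps).
exists N => // n /= Nn.
have := eI n; rewrite uE /in_I => /andP[h1 h2].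
rewrite ger0_norm; last by rewrite -(pmulr_rge0 _ (bX n)).
rewrite -(ler_pM2l (bX n)); apply: (le_trans h2).
rewrite ler_pdivrMr// in NP; apply: (le_trans NP).
by rewrite ler_pM2r// ler_weXn2l// ltW.
Qed.

(** * The Markov chain of tilings and its mirror symmetry *)

Section Tree.
Variables (L : nat) (rule0 : state -> seq (word * state)).
Hypothesis L_gt0 : (0 < L)%N.
Hypothesis rule0P : forall s, valid s -> rich_tiling L (rule0 s) s.1.1 s.1.2.

Definition flip (s : state) : state := (M - s.1.2, M - s.1.1, ~~ s.2).

Definition flip_succ (d : word * state) : word * state :=
  (map (@rev_ord _) d.1, flip d.2).

(* The rule commutes with flip, which is what makes the digits k and m - k
   equally frequent. *)
Definition rule (s : state) : seq (word * state) :=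
  if s.2 then rule0 s else map flip_succ (rule0 (flip s)).

Lemma flipK : involutive flip.
Proof. by move=> [[a c] b]; rewrite /flip/= !subKr negbK. Qed.

Lemma flip_succK : involutive flip_succ.
Proof.
by move=> [w s]; rewrite /flip_succ/= flipK -map_comp (eq_map (@rev_ordK _)) map_id.
Qed.

Lemma len_flip s : len (flip s) = len s.
Proof. by rewrite /len/=; ring. Qed.

Lemma valid_flip s : valid (flip s) = valid s.
Proof.
rewrite /valid len_flip /=; have -> : (0 <= M - s.1.2) = (s.1.2 <= M) by rewrite subr_ge0.
have -> : (M - s.1.1 <= M) = (0 <= s.1.1) by rewrite lerBlDr lerDl.
by rewrite andbCA.
Qed.

Lemma rich_tiling_flip n l a c : rich_tiling n l a c ->
  rich_tiling n (map flip_succ l) (M - c) (M - a).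
Proof.
move=> [[l1 l2 l3] l4]; split; [split|].
- by move=> _ /mapP[d /l1[d1 d2] ->]; rewrite size_map valid_flip.
- rewrite big_map (eq_bigr (fun d => len d.2)) => [|d _]; last exact: len_flip.
  by rewrite l2; ring.
- move=> x /andP[x1 x2].
  have [|d dl /andP[d1 d2]] := l3 (M - x); first by apply/andP; split; lra.
  exists (flip_succ d); first exact: map_f.
  by rewrite -[x](subKr M) /= psi_rev; apply/andP; split; lra.
move=> s; have [d dl [dE da]] := l4 (~~ s).
exists (flip_succ d); first exact: map_f.
split; last exact: has_alternative_rev.
by rewrite /= dE /flip /= negbK subrr subr0.
Qed.

Lemma ruleP s : valid s -> rich_tiling L (rule s) s.1.1 s.1.2.
Proof.
move=> sv; rewrite /rule; case: ifP => _; first exact: rule0P.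
rewrite -[s.1.1](subKr M) -[s.1.2](subKr M).
by apply: rich_tiling_flip; apply: (rule0P (flip s)); rewrite valid_flip.
Qed.

Lemma rule_flip s : rule (flip s) = map flip_succ (rule s).
Proof.
rewrite /rule /=; case: (s.2) => /=; first by rewrite flipK.
by rewrite -map_comp (eq_map flip_succK) map_id.
Qed.

(** The share of [s] taken by the tile of [d], whose length is [len d.2 / beta ^+ L]: the transition
    probability for a uniformly chosen point. *)
Definition wt (s : state) (d : word * state) : R := len d.2 / (beta ^+ L * len s).

Let s0 : state := (0, M, true).
Let kappa : R := (beta ^+ L)^-1.

Let kappa_gt0 : 0 < kappa. Proof. by rewrite invr_gt0. Qed.

Lemma valid_s0 : valid s0.
Proof. by rewrite /valid /len /= lexx subr0 lexx /= /delta; have := M_gt1; lra. Qed.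

Lemma len_gt0 s : valid s -> 0 < len s.
Proof. by move=> /and3P[_ _]; exact: lt_le_trans. Qed.

Lemma rule_valid s d : valid s -> d \in rule s -> valid d.2.
Proof. by move=> /ruleP[[h _ _] _] /h[]. Qed.

Lemma wt_ge0 s : valid s -> forall d, d \in rule s -> 0 <= wt s d.
Proof.
move=> sv d /(rule_valid _ _ sv)/len_gt0/ltW h.
by rewrite divr_ge0// mulr_ge0 ?ltW ?len_gt0.
Qed.

Lemma wt_sum s : valid s -> \sum_(d <- rule s) wt s d = 1.
Proof.
move=> sv; have [[_ h _] _] := ruleP _ sv.
by rewrite -mulr_suml h divff// gt_eqF// mulr_gt0// len_gt0.
Qed.

Lemma wt_full s d b : valid s -> d.2 = (0, M, b) -> kappa <= wt s d.
Proof.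
move=> sv dE; rewrite /wt dE [len (_, _)]/len/= subr0 invfM mulrCA ler_peMr//.
  exact: ltW.
rewrite ler_pdivlMr ?len_gt0// mul1r.
by move: sv => /and3P[h1 h2 _]; rewrite /len; lra.
Qed.

Lemma to_s0 s : valid s -> exists2 d, d \in rule s & d.2 = s0 /\ kappa <= wt s d.
Proof.
move=> sv; have [_ /(_ true)[d ds [dE _]]] := ruleP _ sv.
by exists d => //; split=> //; exact: wt_full dE.
Qed.

(** Starting from the mirrored state amounts to reading mirrored labels, because [rule] commutes
    with [flip] and [wt] only sees lengths. *)
Lemma mean_flip (g : word -> R) n s :
  chain_mean _ _ _ rule wt g n (flip s) =
  chain_mean _ _ _ rule wt (g \o map (@rev_ord _)) n s.
Proof.
elim: n s => [//|n IH] s /=; rewrite rule_flip big_map; apply: eq_bigr => d _.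
by rewrite IH /wt !len_flip.
Qed.

Definition next (s : state) (x : R) : word * state :=
  nth ([::], s) (rule s) (find (fun d => d.2.1.1 <= psi x d.1 <= d.2.1.2) (rule s)).

Definition block (z : state * R) : word := (next z.1 z.2).1.

Definition step (z : state * R) : state * R :=
  ((next z.1 z.2).2, psi z.2 (block z)).

Definition inside (z : state * R) : bool :=
  valid z.1 && (z.1.1.1 <= z.2 <= z.1.1.2).

(** The tiles cover the state, so the default value in [next] is never reached from an [inside]
    pair. *)
Lemma nextP z : inside z -> next z.1 z.2 \in rule z.1 /\ inside (step z).
Proof.
move=> /andP[zv zx]; have [[h1 _ h3] _] := ruleP _ zv.
have [d ds dx] := h3 _ zx.
have hs : has (fun d => d.2.1.1 <= psi z.2 d.1 <= d.2.1.2) (rule z.1).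
  by apply/hasP; exists d.
have nr : next z.1 z.2 \in rule z.1 by rewrite mem_nth// -has_find.
split=> //; rewrite /inside (rule_valid _ _ zv nr)/=.
exact: (nth_find ([::], z.1) hs).
Qed.

Lemma inside_iter n z : inside z -> inside (iter n step z).
Proof. by move=> zi; elim: n => //= n /nextP[]. Qed.

Lemma size_block z : inside z -> size (block z) = L.
Proof.
move=> /[dup] /andP[zv _] /nextP[h _].
by have [[/(_ _ h)[]]] := ruleP _ zv.
Qed.

Definition psum (g : word -> R) n z : R := \sum_(i < n) g (block (iter i step z)).

Lemma psumS g n z : psum g n.+1 z = g (block z) + psum g n (step z).
Proof.
rewrite /psum big_ord_recl/=; congr (_ + _); apply: eq_bigr => i _.
by rewrite -iterSr.
Qed.

(* Chebyshev's inequality, with interval covers in place of measurable sets. *)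
Lemma psum_cover (g : word -> R) n s a t : 0 < t -> valid s ->
  interval_cover
    [set x | s.1.1 <= x <= s.1.2 /\ t <= (a + psum g n (s, x)) ^+ 2]
    (len s * chain_sqmean _ _ _ rule wt g n s a / t).
Proof.
move=> t0; elim: n s a => [|n IH] s a sv /=.
  have l0 := ltW (len_gt0 _ sv).
  have [ta|at'] := leP t (a ^+ 2).
    exists [:: s.1]; split.
    - by move=> i; rewrite inE => /eqP->; rewrite -subr_ge0.
    - by move=> x [sx _]; exists s.1; rewrite ?inE.
    by rewrite big_seq1 -/(len s) -mulrA ler_peMr// ler_pdivlMr// mul1r.
  exists [::]; split=> //.
    by move=> x [_]; rewrite /psum big_ord0 addr0 leNgt at'.
  by rewrite big_nil; apply: divr_ge0; [rewrite mulr_ge0 ?sqr_ge0|exact: ltW].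
have lE : len s * (\sum_(d <- rule s) wt s d *
    chain_sqmean _ _ _ rule wt g n d.2 (a + g d.1)) / t =
    \sum_(d <- rule s) (len d.2 *
    chain_sqmean _ _ _ rule wt g n d.2 (a + g d.1) / t) / beta ^+ L.
  rewrite mulr_sumr mulr_suml; apply: eq_bigr => d _; rewrite /wt; field.
  by rewrite !gt_eqF ?len_gt0.
rewrite lE.
(* The points that the word of [d] sends to exceptional points of its target state; the induction
   hypothesis is pulled back by this affine map. *)
pose A d := [set x | [set y | d.2.1.1 <= y <= d.2.1.2 /\
  t <= (a + g d.1 + psum g n (d.2, y)) ^+ 2] (beta ^+ L * x + psi 0 d.1)].
apply: (interval_coverS _ [set x | exists2 d, d \in rule s & A d x]) (lexx _) _.
  move=> x [sx tx]; have zi : inside (s, x) by rewrite /inside sv.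
  have [ns] := nextP _ zi; exists (next s x) => //.
  have [[/(_ _ ns)[sz _] _ _] _] := ruleP _ sv.
  rewrite /A /= -[in beta ^+ L]sz -psiE; split.
    by have := (nextP _ zi).2 => /andP[].
  by move: tx; rewrite psumS addrA.
apply: interval_cover_bigU => d ds; apply: interval_cover_affine => //.
by apply: IH; exact: rule_valid ds.
Qed.

(** Only square times are sampled: this is what Borel-Cantelli yields and what [cvg_average_squares]
    requires. *)
Definition typical (g : word -> R) (mu : R) (y : R) : Prop :=
  forall eps : R, 0 < eps -> exists J, forall j, (J <= j)%N ->
    `|psum g (j ^ 2) (s0, y) - (j ^ 2)%:R * mu| <= eps * (j ^ 2)%:R.

Let atypical (g : word -> R) (mu eps : R) (w : word) (j : nat) : set R :=
  [set x | in_I (psi x w) /\ eps ^+ 2 * ((j.+1 ^ 2)%:R) ^+ 2 <=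
     (- ((j.+1 ^ 2)%:R * mu) + psum g (j.+1 ^ 2) (s0, psi x w)) ^+ 2].

Lemma atypical_negligible g mu C eps w : 0 <= C -> 0 < eps ->
  (forall n s, valid s ->
    chain_sqmean _ _ _ rule wt g n s (- (n%:R * mu)) <= C * n.+1%:R) ->
  (@lebesgue_measure R).-negligible
    [set x | forall N, exists2 j, (N <= j)%N & atypical g mu eps w j x].
Proof.
(* Chebyshev at time [n = (j + 1) ^ 2] gives [M * C * (n + 1) / (eps * n) ^ 2], and
   [n + 1 <= 2 n]. *)
move=> C0 eps0 CP; pose K := M * (C * 2) / eps ^+ 2.
have K0 : 0 <= K by rewrite !mulr_ge0 ?invr_ge0 ?exprn_ge0// ltW.
apply: (@limsup_cover_negligible _ _ (fun j => K * (j.+1%:R ^+ 2)^-1) (K * 2));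
  last first.
  by move=> n; rewrite -mulr_sumr ler_wpM2l ?sum_inv_sqr_le.
move=> j; set n := (j.+1 ^ 2)%N; set t := eps ^+ 2 * n%:R ^+ 2.
have n0 : (0 < n)%N by rewrite expn_gt0.
have n0' : 0 < n%:R :> R by rewrite ltr0n.
have t0 : 0 < t by rewrite mulr_gt0 ?exprn_gt0.
have := psum_cover g n s0 (- (n%:R * mu)) t t0 valid_s0.
move=> /(interval_cover_affine _ _ _ (psi 0 w) (bX (size w))).
apply: interval_coverS.
  by move=> x; rewrite /atypical /= -psiE => -[].
rewrite ler_pdivrMr//; apply: (@le_trans _ _ (K * (j.+1%:R ^+ 2)^-1 * 1)); last first.
  apply: ler_wpM2l; first by rewrite mulr_ge0 ?invr_ge0 ?exprn_ge0.
  by rewrite exprn_ege1// ltW.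
rewrite mulr1 -natrX -/n ler_pdivrMr//.
have -> : K * n%:R^-1 * t = M * (C * (2 * n%:R)).
  by rewrite /K /t; field; rewrite !gt_eqF.
have -> : len s0 = M by rewrite /len/= subr0.
rewrite ler_pM2l//; apply: (le_trans (CP _ _ valid_s0)).
by rewrite ler_wpM2l// -natrM ler_nat mul2n -addnn -addn1 leq_add.
Qed.

(** Countably many null sets, one for each word and each [eps = 1 / (p + 1)], are discarded. All
    words are needed because a switch of digits may lead to any [psi x w]. *)
Lemma typical_ae g mu C : 0 <= C ->
  (forall n s, valid s ->
    chain_sqmean _ _ _ rule wt g n s (- (n%:R * mu)) <= C * n.+1%:R) ->
  {ae (@lebesgue_measure R), forall x, forall w : seq 'I_m.+1,
    in_I (psi x w) -> typical g mu (psi x w)}.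
Proof.
move=> C0 CP.
pose bad (wp : seq 'I_m.+1 * nat) : set R :=
  [set x | forall N, exists2 j, (N <= j)%N & atypical g mu wp.2.+1%:R^-1 wp.1 j x].
have : {ae (@lebesgue_measure R), forall x, forall n : nat,
    if unpickle n is Some wp then ~ bad wp x else True}.
  apply: ae_foralln => n; case: (unpickle n) => [wp|]; last exact: aeW.
  have := atypical_negligible g mu C wp.2.+1%:R^-1 wp.1 C0 _ CP.
  move=> /(_ _)/negligibleS; apply; last by rewrite invr_gt0.
  by move=> x /= /contrapT.
apply: negligibleS => x /=; apply: contra_not => xP w wx eps eps0.
have [p pe] : exists p : nat, p.+1%:R^-1 <= eps.
  exists (Num.truncn eps^-1).
  have /andP[_ /ltW h] := truncn_itv (ltW (etrans (invr_gt0 eps) eps0)).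
  by rewrite -[leRHS]invrK lef_pV2// ?posrE ?invr_gt0.
have := xP (pickle (w, p)); rewrite pickleK => /existsNP[N NP].
(* The index is shifted since [atypical] at [j] concerns the time [(j + 1) ^ 2]. *)
exists N.+1 => -[//|j]; rewrite ltnS => Nj.
have h : ~ atypical g mu p.+1%:R^-1 w j x by move=> h; apply: NP; exists j.
rewrite leNgt; apply/negP => lt; apply: h; split=> //.
rewrite -exprMn addrC -[leRHS]real_normK ?num_real//.
rewrite lerXn2r ?nnegrE ?mulr_ge0 ?invr_ge0//.
by apply: (le_trans _ (ltW lt)); rewrite ler_wpM2r.
Qed.

Lemma chain_rate_rule (g : word -> R) (G : R) : (forall w, 0 <= g w <= G) ->
  exists mu C, 0 <= C /\ forall n s, valid s ->
  chain_sqmean _ _ _ rule wt g n s (- (n%:R * mu)) <= C * n.+1%:R /\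
  `|chain_mean _ _ _ rule wt g n s - n%:R * mu| <= C.
Proof.
move=> gG; exact: (chain_rate _ _ _ _ _ _ _ _ valid_s0 kappa_gt0
  rule_valid wt_ge0 wt_sum to_s0 _ _ gG).
Qed.

(** Truncation to [L] bounds the count on all words and changes nothing on blocks, which have length
    [L]. *)
Let digit_count (k : 'I_m.+1) (w : word) : R := (count_mem k (take L w))%:R.

Lemma digit_count_bound k w : 0 <= digit_count k w <= L%:R.
Proof.
rewrite /digit_count ler0n ler_nat (leq_trans (count_size _ _))//.
by rewrite size_take; case: ltnP => // /ltnW.
Qed.

Lemma digit_count_rev k w :
  digit_count (rev_ord k) (map (@rev_ord _) w) = digit_count k w.
Proof.
rewrite /digit_count -map_take count_map; congr _%:R; apply: eq_count => i /=.
by rewrite (inj_eq rev_ord_inj).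
Qed.

(** By [mean_flip], [m - k] has from [flip s0] the same means as [k] from [s0]; since rates do not
    depend on the starting state, the two rates agree. *)
Lemma digit_rates : exists mu : 'I_m.+1 -> R, (forall k, mu (rev_ord k) = mu k) /\
  forall k, {ae (@lebesgue_measure R), forall x, forall w : seq 'I_m.+1,
    in_I (psi x w) -> typical (digit_count k) (mu k) (psi x w)}.
Proof.
have /choice[mu /choice[C muC]] k := chain_rate_rule _ _ (digit_count_bound k).
exists mu; split=> k; last first.
  by have [C0 h] := muC k; exact: (typical_ae _ _ _ C0 (fun n s sv => (h n s sv).1)).
have [_ h1] := muC k; have [_ h2] := muC (rev_ord k).
apply: (rate_unique _ _ _ _ _ (fun n => (h2 n (flip s0) _).2)) => [|n].
  by rewrite valid_flip valid_s0.
rewrite mean_flip (_ : _ \o _ = digit_count k); first exact: (h1 n s0 valid_s0).2.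
by apply/funext => w; exact: digit_count_rev.
Qed.

Let alternative_count (w : word) : R := (`[< has_alternative w >])%:R.

(** Every step meets a tile with an alternative with probability at least [kappa], so the mean grows
    linearly and its rate cannot vanish. *)
Lemma alternative_rate : exists2 mu, 0 < mu &
  {ae (@lebesgue_measure R), forall x, forall w : seq 'I_m.+1,
    in_I (psi x w) -> typical alternative_count mu (psi x w)}.
Proof.
have g01 w : 0 <= alternative_count w <= 1.
  by rewrite /alternative_count; case: asbool; rewrite /= ?lexx ?ler01.
have [mu [C [C0 muC]]] := chain_rate_rule _ _ g01.
exists mu; last exact: (typical_ae _ _ _ C0 (fun n s sv => (muC n s sv).1)).
have kn n : n%:R * kappa <= C + n%:R * mu.
  have [_] := muC n s0 valid_s0; rewrite ler_norml => /andP[_ h].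
  apply: le_trans (_ : chain_mean _ _ _ rule wt alternative_count n s0 <= _); last by lra.
  apply: (chain_mean_ge _ _ _ _ _ _ _ kappa_gt0 rule_valid wt_ge0 wt_sum
    _ _ g01 _ _ valid_s0).
  move=> s sv; have [_ /(_ true)[d ds [dE da]]] := ruleP _ sv.
  exists d => //; split; first exact: wt_full dE.
  by rewrite /alternative_count asboolT.
rewrite ltNge; apply/negP => mu0.
have kC n : n%:R * kappa <= C.
  by apply: (le_trans (kn n)); rewrite gerDl; exact: mulr_ge0_le0.
have /andP[_ t] := truncn_itv (divr_ge0 C0 (ltW kappa_gt0)).
have := kC (Num.truncn (C / kappa)).+1; apply/negP; rewrite -ltNge.
by rewrite -ltr_pdivrMr.
Qed.

(** * Balanced expansions obtained from the coding *)

Let word_upto (w : word) (z : state * R) (n : nat) : word :=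
  w ++ flatten (mkseq (fun i => block (iter i step z)) n).

Let word_uptoS w z n :
  word_upto w z n.+1 = word_upto w z n ++ block (iter n step z).
Proof. by rewrite /word_upto mkseqS flatten_rcons catA. Qed.

Let size_word_upto w z n : inside z -> size (word_upto w z n) = (size w + n * L)%N.
Proof.
move=> zi; elim: n => [|n IH]; first by rewrite /word_upto cats0 addn0.
by rewrite word_uptoS size_cat IH size_block ?inside_iter// mulSn; lia.
Qed.

Let psi_word_upto x w s n :
  psi x (word_upto w (s, psi x w) n) = (iter n step (s, psi x w)).2.
Proof.
elim: n => [|n IH]; first by rewrite /word_upto cats0.
by rewrite word_uptoS psi_cat IH.
Qed.

Let count_word_upto k w z n : inside z ->
  (count_mem k (word_upto w z n))%:R = (count_mem k w)%:R + psum (digit_count k) n z.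
Proof.
move=> zi; elim: n => [|n IH].
  by rewrite /word_upto cats0 /psum big_ord0 addr0.
rewrite word_uptoS count_cat natrD IH /psum big_ord_recr/= addrA; congr (_ + _).
by rewrite /digit_count take_oversize// size_block// inside_iter.
Qed.

Let inside_in_I z : inside z -> in_I z.2.
Proof.
move=> /andP[/and3P[h1 h2 _] /andP[h3 h4]].
by rewrite /in_I (le_trans h1)// (le_trans h4).
Qed.

Let inside_s0 x : in_I x -> inside (s0, x).
Proof. by move=> h; rewrite /inside valid_s0. Qed.

(** After [w] the coding is restarted at [psi x w] from the state [s0]; the finite prefix does not
    affect frequencies. *)
Lemma balanced_expansion_extending x w (mu : 'I_m.+1 -> R) :
  (forall k, mu (rev_ord k) = mu k) -> in_I (psi x w) ->
  (forall k, typical (digit_count k) (mu k) (psi x w)) ->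
  exists e : nat -> 'I_m.+1,
    [/\ series (fun i : nat => (e i)%:R / beta ^+ i.+1) @ \oo --> x,
        balanced R e & mkseq e (size w) = w].
Proof.
move=> mur wI wT; pose z : state * R := (s0, psi x w).
have zi : inside z by exact: inside_s0.
have [||e eP] := @prefix_chain_limit _ (ord0 : 'I_m.+1) (word_upto w z)
  (fun n => block (iter n step z)).
- exact: word_uptoS.
- by move=> n; rewrite size_block ?inside_iter.
exists e; split; last by have := eP 0%N; rewrite /word_upto /= cats0.
  apply: expansion_cvg => n.
  have nu : (n <= size (word_upto w z n))%N by rewrite size_word_upto//; nia.
  apply: (in_I_psi _ (drop n (word_upto w z n))).
  rewrite -psi_cat -(take_mkseq _ _ _ nu) eP cat_take_drop psi_word_upto.
  exact/inside_in_I/inside_iter.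
have fcvg k : digit_freq_seq R e k @ \oo --> mu k / L%:R.
  rewrite (_ : digit_freq_seq R e k =
    fun n => (count_mem k (mkseq e n))%:R / n%:R); last first.
    by apply/funext => n; exact: digit_freq_seqE.
  apply: (@cvg_average_squares _ (fun n => count_mem k (mkseq e n)) (size w)) => //.
    move=> n p; rewrite /mkseq iotaD map_cat count_cat leq_addr leq_add2l.
    by rewrite (leq_trans (count_size _ _))// size_map size_iota.
  move=> eps eps0; have eps2 : 0 < eps / 2 by rewrite divr_gt0.
  have [J JP] := wT k _ eps2.
  set c : R := (count_mem k w)%:R.
  have c0 : 0 <= c / (eps / 2) by rewrite divr_ge0// ltW.
  have /andP[_ t] := truncn_itv c0.
  (* The second bound makes the digits of the prefix [w] cost at most [eps / 2 * j ^ 2]. *)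
  exists (maxn J (Num.truncn (c / (eps / 2))).+1) => j.
  rewrite geq_max => /andP[Jj tj].
  rewrite -(size_word_upto w z)// eP count_word_upto// -/c.
  have := JP j Jj; rewrite -/z => h.
  rewrite -addrA; apply: (le_trans (ler_normD _ _)).
  rewrite [eps * _](_ : _ = eps / 2 * (j ^ 2)%:R + eps / 2 * (j ^ 2)%:R); last by lra.
  apply: lerD => //; rewrite ger0_norm ?ler0n// mulrC -ler_pdivrMr//.
  apply: (le_trans (ltW t)); rewrite ler_nat (leq_trans tj)//.
  by rewrite -mulnn leq_pmulr// (leq_trans _ tj).
have fE k : Freq R k e = mu k / L%:R by apply/cvg_lim => //; exact: fcvg.
split=> k; first by apply/cvg_ex; exists (mu k / L%:R); exact: fcvg.
by rewrite !fE mur.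
Qed.

(** If no alternative occurred from block [n] on, the sums would stay below [n] instead of growing
    at rate [mu]. *)
Lemma alternatives_unbounded x mu : 0 < mu ->
  typical alternative_count mu x ->
  forall n, exists2 j, (n <= j)%N & has_alternative (block (iter j step (s0, x))).
Proof.
move=> mu0 xT n; apply: contrapT => nP.
have psum_le i : psum alternative_count i (s0, x) <= n%:R.
  rewrite /psum -natr_sum ler_nat.
  apply: (@leq_trans (\sum_(j < i) (j < n)%N)); last first.
    apply: (@leq_trans (minn i n)); last exact: geq_minr.
    elim: i => [|i IH]; first by rewrite big_ord0.
    rewrite big_ord_recr/=; apply: (leq_trans (leq_add IH (leqnn _))).
    by case: (ltnP i n) => /= h; lia.
  apply: leq_sum => j _; case: ltnP => [_|nj]; first exact: leq_b1.
  by rewrite leqn0 eqb0; apply/asboolP => h; apply: nP; exists j.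
have mu2 : 0 < mu / 2 by rewrite divr_gt0.
have [J JP] := xT _ mu2.
have n0 : 0 <= n%:R / (mu / 2) by rewrite divr_ge0// ltW.
have /andP[_ t] := truncn_itv n0.
pose j := maxn J (Num.truncn (n%:R / (mu / 2))).+1.
have := JP j (leq_maxl _ _); rewrite ler_norml => /andP[h _].
have := psum_le (j ^ 2)%N.
have : n%:R < mu / 2 * (j ^ 2)%:R.
  rewrite mulrC -ltr_pdivrMr//; apply: (lt_le_trans t).
  rewrite ler_nat; apply: (@leq_trans j); first exact: leq_maxr.
  by rewrite -mulnn leq_pmulr// /j leq_max orbT.
by lra.
Qed.

(** The expansion [f j] follows the coding of [x] up to block [j] and leaves it within that block.
    For [i < j], [f j] still follows block [i], where [f i] has left, so the two differ. *)
Lemma infinitely_many_balanced x (mu : 'I_m.+1 -> R) nu :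
  (forall k, mu (rev_ord k) = mu k) -> 0 < nu -> in_I x ->
  (forall w k, in_I (psi x w) -> typical (digit_count k) (mu k) (psi x w)) ->
  typical alternative_count nu x ->
  infinite_set [set e : nat -> 'I_m.+1 |
    series (fun i : nat => (e i)%:R / beta ^+ i.+1) @ \oo --> x /\ balanced R e].
Proof.
move=> mur nu0 xI xT xA.
pose z : state * R := (s0, x); have zi : inside z by exact: inside_s0.
pose u := word_upto [::] z; pose b j := block (iter j step z).
pose P j (e : nat -> 'I_m.+1) :=
  [/\ series (fun i : nat => (e i)%:R / beta ^+ i.+1) @ \oo --> x, balanced R e &
   exists w', [/\ (size w' <= size (b j))%N, take (size w') (b j) <> w' &
     mkseq e (size (u j ++ w')) = u j ++ w']].
have /choice[f fP] j : exists e, has_alternative (b j) -> P j e.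
  have [[w' [w1 w2 w3]]|nb] := pselect (has_alternative (b j)); last first.
    by exists (fun=> ord0).
  have wI : in_I (psi x (u j ++ w')).
    rewrite psi_cat; apply: w3; rewrite -psi_cat -word_uptoS.
    rewrite (psi_word_upto x [::]); exact/inside_in_I/inside_iter.
  have [e [e1 e2 e3]] := balanced_expansion_extending _ _ _ mur wI (fun k => xT _ k wI).
  by exists e => _; split=> //; exists w'.
apply: (@infinite_set_unbounded _ _ (fun j => has_alternative (b j)) f).
- exact: alternatives_unbounded nu0 xA.
- by move=> j /fP[].
move=> i j /fP[_ _ [wi [i1 i2 i3]]] /fP[_ _ [wj [_ _ j3]]] ij fij.
have [v vE] : exists v, u j = u i ++ b i ++ v.
  elim: j ij {j3 fij} => // j IH; rewrite ltnS leq_eqVlt => /predU1P[<-|/IH[v vE]].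
    by exists [::]; rewrite cats0; exact: word_uptoS.
  by exists (v ++ b j); rewrite {1}/u word_uptoS -/(u j) vE -!catA.
apply: i2; have : take (size (u i ++ wi)) (u j ++ wj) = u i ++ wi.
  rewrite -j3 -fij take_mkseq// vE !size_cat; lia.
rewrite vE size_cat -catA takeD take_size_cat// drop_size_cat// => /eqP.
by rewrite eqseq_cat// eqxx/= -catA takel_cat// => /eqP.
Qed.

Lemma ae_infinitely_many_balanced :
  {ae (@lebesgue_measure R), forall x, in_I x ->
    infinite_set [set e : nat -> 'I_m.+1 |
    series (fun i : nat => (e i)%:R / beta ^+ i.+1) @ \oo --> x /\ balanced R e]}.
Proof.
have [mu [mur muT]] := digit_rates.
have [nu nu0 nuT] := alternative_rate.
(* Digits are indexed by natural numbers through [inord], to fit a countable intersection. *)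
have /ae_foralln H : forall n, {ae (@lebesgue_measure R),
    forall x, (forall w : seq 'I_m.+1, in_I (psi x w) ->
      typical alternative_count nu (psi x w)) /\
    forall w : seq 'I_m.+1, in_I (psi x w) ->
      typical (digit_count (inord n)) (mu (inord n)) (psi x w)}.
  move=> n; apply: negligibleS (negligibleU nuT (muT (inord n))).
  by move=> x /= /not_andP[]; [left|right].
apply: negligibleS H => x /=; apply: contra_not => xP xI.
apply: (infinitely_many_balanced x mu nu) => //.
  by move=> w k wI; have [_ /(_ w wI)] := xP k; rewrite inord_val.
by have [h _] := xP 0%N; exact: (h [::] xI).
Qed.

End Tree.

End BetaMaps.

Theorem theorem1p2 (R : realType) (beta : R)
    (beta_gt1 : 1 < beta) (beta_nonint : beta \isn't a Num.nat) :
  {ae (@lebesgue_measure R), forall x : R, I_beta beta x ->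
    infinite_set [set e : nat -> 'I_(Num.truncn beta).+1 |
      is_beta_expansion x e /\ balanced R e]}.
Proof.
have /andP[_ beta_lt] := truncn_itv (ltW (lt_trans ltr01 beta_gt1)).
have [L L0 tilings] := rich_tiling_exists _ _ _ beta_gt1 beta_lt.
(* The rule must be total, so invalid states get the empty list. *)
have /choice[rule0 rule0P] (s : R * R * bool) : exists l,
    valid R (Num.truncn beta) beta s ->
    rich_tiling R (Num.truncn beta) beta L l s.1.1 s.1.2.
  case: (boolP (valid _ _ _ s)) => [sv|_]; last by exists [::].
  by case: s sv => [[a c] b] /tilings[l]; exists l.
exact: (ae_infinitely_many_balanced _ _ _ beta_gt1 beta_lt _ _ L0 rule0P).
Qed.
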